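(* Let $(X,\mathcal{A},\mu)$ be a separable $\sigma$-finite measure space with $\dim L^1(X,\mathcal{A},\mu)\neq 1$, and let $\mathfrak{Q}$ be the set of all quadratic stochastic operators on $L^1=L^1(X,\mathcal{A},\mu)$, equipped with the metric $d_u$. Then the set $\mathfrak{Q}_{nqm}\subseteq\mathfrak{Q}$ of all norm quasi-mixing quadratic stochastic operators is a dense and open subset of $\mathfrak{Q}$ for the metric $d_u$.
   Context: $L^1=L^1(X,\mathcal{A},\mu)$ is the (separable) Banach lattice of real $\mu$-integrable functions with norm $\Vert f\Vert_1=\int_X|f|\,d\mu$, and $\mathcal{D}=\{f\in L^1: f\ge 0,\ \Vert f\Vert_1=1\}$ is the set of densities. A quadratic stochastic operator on $L^1$ is a bilinear operator $\mathbf{Q}\colon L^1\times L^1\to L^1$ such that for all $f,g\in L^1$ with $f,g\ge 0$: $\mathbf{Q}(f,g)\ge 0$, $\mathbf{Q}(f,g)=\mathbf{Q}(g,f)$ and $\Vert\mathbf{Q}(f,g)\Vert_1=\Vert f\Vert_1\Vert g\Vert_1$. The set of all of them is $\mathfrak{Q}$. For $\mathbf{Q}\in\mathfrak{Q}$ define $\mathbb{Q}\colon\mathcal{D}\to\mathcal{D}$ by $\mathbb{Q}(f)=\mathbf{Q}(f,f)$, and let $\mathbb{Q}^n$ be its $n$-th iterate ($\mathbb{Q}^0$ is the identity). The metric on $\mathfrak{Q}$ is $d_u(\mathbf{Q}_1,\mathbf{Q}_2)=\sup_{f\in\mathcal{D}}\Vert\mathbb{Q}_1(f)-\mathbb{Q}_2(f)\Vert_1$.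 For $\mathbf{Q}\in\mathfrak{Q}$ and $f\in\mathcal{D}$, the nonhomogeneous Markov chain associated with $\mathbf{Q}$ and $f$ is the sequence of Markov operators $P_f^{[n,n+1]}\colon L^1\to L^1$, $n\ge 0$, given by $P_f^{[n,n+1]}(h)=\mathbf{Q}(\mathbb{Q}^n(f),h)$. For $0\le m<n$ put $P_f^{[m,n]}(h)=P_f^{[n-1,n]}(P_f^{[n-2,n-1]}(\cdots(P_f^{[m,m+1]}(h))\cdots))$, and $P_f^{[n,n]}$ is the identity. $\mathbf{Q}\in\mathfrak{Q}$ is called norm quasi-mixing if $\lim_{n\to\infty}\sup_{f,g,h\in\mathcal{D}}\Vert P_f^{[0,n]}(g)-P_f^{[0,n]}(h)\Vert_1=0$. The set of norm quasi-mixing operators is denoted $\mathfrak{Q}_{nqm}$. *)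

(* Defs.v *)
From HB Require Import structures.
From mathcomp Require Import all_boot all_order all_algebra.
From mathcomp Require Import sesquilinear.
From mathcomp Require Import all_classical all_reals all_analysis.
From mathcomp Require Import lra.
From mathcomp Require Import measurable_realfun.

Set Implicit Arguments.
Unset Strict Implicit.
Unset Printing Implicit Defensive.

Import Order.TTheory GRing.Theory Num.Theory.
Import numFieldNormedType.Exports.

Local Open Scope classical_set_scope.
Local Open Scope ring_scope.

(* Separability, for the pseudo-metric mu (A `+` B), of the family of measurable
   sets of finite measure. *)
Definition separable_measure (R : realType) (d : measure_display)
    (X : measurableType d) (mu : set X -> \bar R) : Prop :=
  exists C : set (set X),
    [/\ countable C,
        C `<=` [set A | measurable A /\ (mu A < +oo)%E] &
        forall A : set X, measurable A -> (mu A < +oo)%E ->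
        forall e : R, 0 < e -> exists2 B, C B & (mu (A `+` B) < e%:E)%E].

(* V has a basis with n elements. *)
Definition has_dim (K : nzRingType) (V : lmodType K) (n : nat) : Prop :=
  exists b : 'I_n -> V,
    forall v : V, exists! c : 'rV[K]_n, v = \sum_(i < n) c 0 i *: b i.

Lemma polarization_cancel (K : numFieldType) (V : lmodType K) (a b c c' : V) :
  a + c + (c + b) = a + c' + (c' + b) -> c = c'.
Proof.
move=> H; have n2 : (2 : K) != 0 by rewrite pnatr_eq0.
apply: (scalerI n2); rewrite !scaler_nat !mulr2n.
apply: (@addrI V a); apply: (@addIr V b).
by rewrite -!addrA; rewrite -!addrA in H.
Qed.

Section L1_space.
Context (R : realType) (d : measure_display) (X : measurableType d).
Variable mu : {measure set X -> \bar R}.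

(* LspaceType1 mu is the type of a.e.-classes of integrable functions; it comes
   without algebraic structure, which is added below by lifting that of
   LfunType along representatives. *)
Definition L1 : Type := LspaceType1 mu.

HB.instance Definition _ := gen_eqMixin L1.
HB.instance Definition _ := gen_choiceMixin L1.

Local Notation aeMfun := {mfun_ mu, X >-> measurableTypeR R}.
Local Notation Lfun1 := (LfunType mu (@lexx _ _ 1%E)).

Definition L1_fun (F : L1) : X -> R := aqEqMfun_to_fun (LebesgueSpace.sort F).

Lemma L1_fun_Lfun (F : L1) : L1_fun F \in Lfun mu 1.
Proof.
apply/andP; split; rewrite inE /=.
  exact: (@measurable_funPT _ _ _ _ (repr (LebesgueSpace.sort F))).
exact: (@Lebesgue_finite _ _ _ _ _ _ F).
Qed.

Definition L1_repr (F : L1) : Lfun1 := Lfun_Sub (@lexx _ _ 1%E) (L1_fun_Lfun F).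

Definition mfun_of_Lfun1 (f : Lfun1) : {mfun X >-> measurableTypeR R} :=
  @MeasurableFun.Pack _ _ X (measurableTypeR R) f
    (MeasurableFun.Class
      (@isMeasurableFun.Build _ _ X (measurableTypeR R) f
        (@measurable_funPT _ _ X R f))).

Definition aeEqMfun_of_Lfun1 (f : Lfun1) : aeMfun :=
  (\pi_aeMfun (mfun_of_Lfun1 f))%qT.

Lemma aeEqMfun_of_Lfun1E (f : Lfun1) : aeEqMfun_of_Lfun1 f = f %[ae mu].
Proof.
have : (\pi_aeMfun (repr (aeEqMfun_of_Lfun1 f)) =
        \pi_aeMfun (mfun_of_Lfun1 f))%qT by rewrite reprK.
by move/eqmodP => /asboolP.
Qed.

Lemma ae_eq_norm1 (f g : X -> R) :
  measurable_fun setT f -> measurable_fun setT g -> f = g %[ae mu] ->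
  ('N[mu]_1[EFin \o f] = 'N[mu]_1[EFin \o g])%E.
Proof.
move=> mf mg fg; rewrite !Lnorm1; apply: ae_eq_integral => //.
- by apply/measurable_EFinP/measurableT_comp.
- by apply/measurable_EFinP/measurableT_comp.
- by apply: filterS fg => x /= /[apply] ->.
Qed.

Lemma aeEqMfun_of_Lfun1_finite (f : Lfun1) :
  finite_norm mu 1 (aeEqMfun_of_Lfun1 f).
Proof.
rewrite /finite_norm (@ae_eq_norm1 _ f) //.
- exact: Lfunction_finite.
- exact: (@measurable_funPT _ _ _ _ (repr (aeEqMfun_of_Lfun1 f))).
- exact: aeEqMfun_of_Lfun1E.
Qed.

Definition L1_class (f : Lfun1) : L1 :=
  @LebesgueSpace.Pack _ _ _ mu _ (@lexx _ _ 1%E) (aeEqMfun_of_Lfun1 f)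
    (LebesgueSpace.Class
      (isFinLebesgue.Build _ _ _ mu _ (@lexx _ _ 1%E) (aeEqMfun_of_Lfun1 f)
        (aeEqMfun_of_Lfun1_finite f))).

Lemma L1_classE (f : Lfun1) : L1_fun (L1_class f) = f %[ae mu].
Proof. exact: aeEqMfun_of_Lfun1E. Qed.

Lemma L1_fun_eq (F G : L1) : L1_fun F = L1_fun G %[ae mu] -> F = G.
Proof.
move: F G => [F [[hF]]] [G [[hG]]] /= FG.
have {FG}E : F = G.
  rewrite -[F]reprK -[G]reprK; apply/eqmodP; exact/asboolP.
by subst G; rewrite (Prop_irrelevance hF hG).
Qed.

Lemma L1_class_eq (f g : Lfun1) : L1_class f = L1_class g <-> f = g %[ae mu].
Proof.
split=> [E|E].
  apply: (ae_eq_trans _ (L1_classE g)); rewrite -E.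
  exact/ae_eq_sym/L1_classE.
apply: L1_fun_eq; apply: (ae_eq_trans (L1_classE f)).
by apply: (ae_eq_trans E); exact/ae_eq_sym/L1_classE.
Qed.

Lemma L1_reprK : cancel L1_repr L1_class.
Proof. by move=> F; apply: L1_fun_eq; exact: L1_classE. Qed.

Lemma L1_classK (f : Lfun1) : L1_repr (L1_class f) = f %[ae mu].
Proof. exact: L1_classE. Qed.

Definition L1_zero : L1 := L1_class 0.
Definition L1_opp (F : L1) : L1 := L1_class (- L1_repr F).
Definition L1_add (F G : L1) : L1 := L1_class (L1_repr F + L1_repr G).
Definition L1_scale (a : R) (F : L1) : L1 := L1_class (a *: L1_repr F).

Lemma L1_opp_class (f : Lfun1) : L1_opp (L1_class f) = L1_class (- f).
Proof.
apply/L1_class_eq; apply: filterS (L1_classK f) => x fx _.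
exact: (congr1 -%R (fx I)).
Qed.

Lemma L1_add_class (f g : Lfun1) :
  L1_add (L1_class f) (L1_class g) = L1_class (f + g).
Proof.
apply/L1_class_eq; apply: filterS2 (L1_classK f) (L1_classK g) => x fx gx _.
exact: (congr2 +%R (fx I) (gx I)).
Qed.

Lemma L1_scale_class a (f : Lfun1) : L1_scale a (L1_class f) = L1_class (a *: f).
Proof.
apply/L1_class_eq; apply: filterS (L1_classK f) => x fx _.
exact: (congr1 ( *%R a) (fx I)).
Qed.

Let L1_classP (P : L1 -> Prop) : (forall f, P (L1_class f)) -> forall F, P F.
Proof. by move=> Pc F; rewrite -[F]L1_reprK. Qed.

Lemma L1_addA : associative L1_add.
Proof.
elim/L1_classP=> f; elim/L1_classP=> g; elim/L1_classP=> h.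
by rewrite !L1_add_class addrA.
Qed.

Lemma L1_addC : commutative L1_add.
Proof.
by elim/L1_classP=> f; elim/L1_classP=> g; rewrite !L1_add_class addrC.
Qed.

Lemma L1_add0 : left_id L1_zero L1_add.
Proof. by elim/L1_classP=> f; rewrite L1_add_class add0r. Qed.

Lemma L1_addN : left_inverse L1_zero L1_opp L1_add.
Proof. by elim/L1_classP=> f; rewrite L1_opp_class L1_add_class addNr. Qed.

HB.instance Definition _ :=
  GRing.isZmodule.Build L1 L1_addA L1_addC L1_add0 L1_addN.

Lemma L1_scaleA a b (F : L1) : L1_scale a (L1_scale b F) = L1_scale (a * b) F.
Proof. by elim/L1_classP: F => f; rewrite !L1_scale_class scalerA. Qed.

Lemma L1_scale1 : left_id 1 L1_scale.
Proof. by elim/L1_classP=> f; rewrite L1_scale_class scale1r. Qed.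

Lemma L1_scaleDr : right_distributive L1_scale +%R.
Proof.
move=> a; elim/L1_classP=> f; elim/L1_classP=> g.
by rewrite [_ + _]L1_add_class !L1_scale_class [RHS]L1_add_class scalerDr.
Qed.

Lemma L1_scaleDl (F : L1) : {morph L1_scale^~ F : a b / a + b}.
Proof.
elim/L1_classP: F => f a b.
by rewrite !L1_scale_class [RHS]L1_add_class scalerDl.
Qed.

HB.instance Definition _ := GRing.Zmodule_isLmodule.Build R L1
  L1_scaleA L1_scale1 L1_scaleDr L1_scaleDl.

Lemma L1_class_is_linear : linear L1_class.
Proof.
by move=> a f g; rewrite -L1_add_class -L1_scale_class.
Qed.

HB.instance Definition _ :=
  GRing.isLinear.Build R Lfun1 L1 *:%R L1_class L1_class_is_linear.

Definition L1_norm (F : L1) : R := (\int[mu]_x `|L1_fun F x|)%R.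

Lemma L1_norm_class (f : Lfun1) : L1_norm (L1_class f) = (\int[mu]_x `|f x|)%R.
Proof.
rewrite /L1_norm /Rintegral; congr fine.
have mF : measurable_fun setT (L1_fun (L1_class f)).
  exact: (@measurable_funPT _ _ _ _ (L1_repr (L1_class f))).
have := ae_eq_norm1 mF (@measurable_funPT _ _ _ _ f) (L1_classE f).
by rewrite !Lnorm1.
Qed.

Lemma L1_norm_classE (f : Lfun1) :
  (L1_norm (L1_class f))%:E = 'N[mu]_1[EFin \o f]%E.
Proof.
by rewrite L1_norm_class -(finite_norm_fine f) /Rintegral Lnorm1.
Qed.

Lemma L1_normD (F G : L1) : L1_norm (F + G) <= L1_norm F + L1_norm G.
Proof.
elim/L1_classP: F => f; elim/L1_classP: G => g.
by rewrite -raddfD -lee_fin EFinD !L1_norm_classE eminkowski.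
Qed.

Lemma L1_normZ a (F : L1) : L1_norm (a *: F) = `|a| * L1_norm F.
Proof.
elim/L1_classP: F => f; apply: EFin_inj.
by rewrite -linearZ EFinM !L1_norm_classE -LnormZ.
Qed.

Lemma L1_norm_eq0 (F : L1) : L1_norm F = 0 -> F = 0.
Proof.
elim/L1_classP: F => f f0; rewrite -[RHS](raddf0 L1_class).
apply/L1_class_eq/fine_Lnormr_eq0; rewrite -f0 -L1_norm_classE.
by [].
Qed.

HB.instance Definition _ := Lmodule_isNormed.Build R L1
  L1_normD L1_normZ L1_norm_eq0.

Definition L1_nonneg (F : L1) : Prop := \forall x \ae mu, 0 <= L1_fun F x.

Definition densities : set L1 := [set F | L1_nonneg F /\ `|F| = 1].

Lemma L1_nonneg_class (f : Lfun1) :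
  L1_nonneg (L1_class f) <-> \forall x \ae mu, 0 <= f x.
Proof.
split; apply: filterS2 (L1_classE f) => x fx.
  by rewrite -(fx I).
by rewrite (fx I).
Qed.

Lemma L1_nonnegD (F G : L1) : L1_nonneg F -> L1_nonneg G -> L1_nonneg (F + G).
Proof.
elim/L1_classP: F => f; elim/L1_classP: G => g.
move=> /L1_nonneg_class f0 /L1_nonneg_class g0.
rewrite -raddfD; apply/L1_nonneg_class.
by apply: filterS2 f0 g0 => x; exact: addr_ge0.
Qed.

Lemma L1_nonnegZ a (F : L1) : 0 <= a -> L1_nonneg F -> L1_nonneg (a *: F).
Proof.
move=> a0; elim/L1_classP: F => f /L1_nonneg_class f0.
rewrite -linearZ; apply/L1_nonneg_class.
by apply: filterS f0 => x; exact: mulr_ge0.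
Qed.

Lemma L1_nonneg_sub (F : L1) :
  exists G H, [/\ L1_nonneg G, L1_nonneg H & F = G - H].
Proof.
elim/L1_classP: F => f.
pose g : Lfun1 := Lfun_Sub (@lexx _ _ 1%E) (Lfun_norm (LfunP f)).
exists (L1_class (2^-1 *: (g + f))), (L1_class (2^-1 *: (g - f))); split.
- apply/L1_nonneg_class; apply: aeW => x.
  change (0 <= 2^-1 * (`|f x| + f x)).
  by have := ler_norm (- f x); rewrite normrN; lra.
- apply/L1_nonneg_class; apply: aeW => x.
  change (0 <= 2^-1 * (`|f x| - f x)).
  by have := ler_norm (f x); lra.
- rewrite -raddfB /=; apply: (congr1 L1_class); apply/LfuneqP => x.
  change (f x = 2^-1 * (`|f x| + f x) - 2^-1 * (`|f x| - f x)).
  by lra.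
Qed.

Lemma densities_normalize (F : L1) :
  L1_nonneg F -> F != 0 -> densities (`|F|^-1 *: F).
Proof.
move=> F0 Fn0; split; last by rewrite normfZV.
by apply: L1_nonnegZ => //; rewrite invr_ge0.
Qed.

Record qso := QSO {
  qso_op :> {bilinear L1 -> L1 -> L1} ;
  qso_nonneg : forall f g : L1, L1_nonneg f -> L1_nonneg g ->
    L1_nonneg (qso_op f g) ;
  qso_sym : forall f g : L1, L1_nonneg f -> L1_nonneg g ->
    qso_op f g = qso_op g f ;
  qso_norm : forall f g : L1, L1_nonneg f -> L1_nonneg g ->
    `|qso_op f g| = `|f| * `|g| }.

HB.instance Definition _ := gen_eqMixin qso.
HB.instance Definition _ := gen_choiceMixin qso.

Definition qso_diag (Q : qso) (f : L1) : L1 := Q f f.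

Lemma qso_diag_densities (Q : qso) (f : L1) :
  densities f -> densities (qso_diag Q f).
Proof.
by move=> [f0 f1]; split; [exact: qso_nonneg|rewrite qso_norm// f1 mulr1].
Qed.

(* The real supremum is the true one: the set is bounded by 2, see qso_dist_ub;
   it is empty only when L1 is the null space, and then sup set0 = 0. *)
Definition qso_dist (Q1 Q2 : qso) : R :=
  sup [set `|qso_diag Q1 f - qso_diag Q2 f| | f in densities].

Lemma qso_dist_ub (Q1 Q2 : qso) (f : L1) : densities f ->
  `|qso_diag Q1 f - qso_diag Q2 f| <= qso_dist Q1 Q2.
Proof.
move=> Df; apply: ub_le_sup; last by exists f.
exists 2 => _ [g Dg <-]; apply: (le_trans (ler_normB _ _)).
by rewrite (qso_diag_densities Q1 Dg).2 (qso_diag_densities Q2 Dg).2.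
Qed.

Lemma qso_dist_le (Q1 Q2 : qso) (e : R) : 0 <= e ->
  (forall f, densities f -> `|qso_diag Q1 f - qso_diag Q2 f| <= e) ->
  qso_dist Q1 Q2 <= e.
Proof.
move=> e0 He; rewrite /qso_dist.
have [->|/set0P S0] :=
    eqVneq [set `|qso_diag Q1 f - qso_diag Q2 f| | f in densities] set0.
  by rewrite sup0.
by apply: ge_sup => // _ [f Df <-]; exact: He.
Qed.

Lemma qso_dist_ge0 (Q1 Q2 : qso) : 0 <= qso_dist Q1 Q2.
Proof.
rewrite /qso_dist.
have [->|/set0P [_ [f Df _]]] :=
    eqVneq [set `|qso_diag Q1 f - qso_diag Q2 f| | f in densities] set0.
  by rewrite sup0.
by apply: le_trans (qso_dist_ub Q1 Q2 Df).
Qed.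

Lemma qso_distxx (Q : qso) : qso_dist Q Q = 0.
Proof.
apply/eqP; rewrite eq_le qso_dist_ge0 andbT; apply: qso_dist_le => // f _.
by rewrite subrr normr0.
Qed.

Lemma qso_dist_sym (Q1 Q2 : qso) : qso_dist Q1 Q2 = qso_dist Q2 Q1.
Proof. by congr sup; apply: eq_imagel => f _; rewrite distrC. Qed.

Lemma qso_dist_triangle (Q2 Q1 Q3 : qso) :
  qso_dist Q1 Q3 <= qso_dist Q1 Q2 + qso_dist Q2 Q3.
Proof.
apply: qso_dist_le => [|f Df]; first by rewrite addr_ge0 ?qso_dist_ge0.
apply: (le_trans (ler_distD (qso_diag Q2 f) _ _)).
by apply: lerD; exact: qso_dist_ub.
Qed.

Lemma qso_eq (Q1 Q2 : qso) : (forall f g, Q1 f g = Q2 f g) -> Q1 = Q2.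
Proof.
move: Q1 Q2 => [[b1 [[h1 h2 h3 h4]]] p1 q1 r1] [[b2 [[k1 k2 k3 k4]]] p2 q2 r2].
move=> /= E; have {}E : b1 = b2 by apply/funext => f; apply/funext => g.
subst b2.
rewrite (Prop_irrelevance h1 k1) (Prop_irrelevance h2 k2).
rewrite (Prop_irrelevance h3 k3) (Prop_irrelevance h4 k4) in p1 q1 r1 *.
rewrite (Prop_irrelevance h1 k1) (Prop_irrelevance h2 k2) in p1 q1 r1 *.
by rewrite (Prop_irrelevance p1 p2) (Prop_irrelevance q1 q2)
  (Prop_irrelevance r1 r2).
Qed.

Lemma qso_dist_eq0 (Q1 Q2 : qso) : qso_dist Q1 Q2 = 0 -> Q1 = Q2.
Proof.
move=> Q12.
have diagD f : densities f -> Q1 f f = Q2 f f.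
  move=> Df; apply/eqP; rewrite -subr_eq0 -normr_le0 -Q12.
  exact: qso_dist_ub.
have diag0 f : L1_nonneg f -> Q1 f f = Q2 f f.
  move=> f0; have [->|fn0] := eqVneq f 0; first by rewrite !linear0r.
  have := diagD _ (densities_normalize f0 fn0).
  rewrite !linearZl_LR !linearZr_LR /= => /scalerI E.
  have u0 : `|f|^-1 != 0 by rewrite invr_eq0 normr_eq0.
  by apply: (scalerI u0); apply: E.
have pos f g : L1_nonneg f -> L1_nonneg g -> Q1 f g = Q2 f g.
  move=> f0 g0; have := diag0 _ (L1_nonnegD f0 g0).
  rewrite !linearDl !linearDr /= (diag0 f f0) (diag0 g g0).
  rewrite (qso_sym Q1 g0 f0) (qso_sym Q2 g0 f0).
  exact: polarization_cancel.
apply: qso_eq => f g.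
have [f1 [f2 [f10 f20 ->]]] := L1_nonneg_sub f.
have [g1 [g2 [g10 g20 ->]]] := L1_nonneg_sub g.
by rewrite !linearBl !linearBr /= !pos.
Qed.

HB.instance Definition _ := isMetric.Build R qso
  qso_distxx qso_dist_eq0 qso_dist_sym qso_dist_triangle.

(* The one-step operator P_f^[n, n+1]. *)
Definition qso_step (Q : qso) (f : L1) (n : nat) (h : L1) : L1 :=
  Q (iter n (qso_diag Q) f) h.

(* P_f^[m, n] for m <= n: the steps m, ..., n - 1, step m being applied first. *)
Definition qso_chain (Q : qso) (f : L1) (m n : nat) (h : L1) : L1 :=
  foldl (fun g k => qso_step Q f k g) h (index_iota m n).

Lemma qso_chain_densities (Q : qso) (f g : L1) (m n : nat) :
  densities f -> densities g -> densities (qso_chain Q f m n g).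
Proof.
move=> Df; rewrite /qso_chain; elim: (index_iota m n) g => //= k s IHs g [g0 g1].
apply: IHs; have [Fk0 Fk1] : densities (iter k (qso_diag Q) f).
  by elim: k => //= k; exact: qso_diag_densities.
by split; [exact: qso_nonneg|rewrite qso_norm// Fk1 g1 mulr1].
Qed.

(* As for qso_dist, the set is bounded, and empty only when L1
   is the null space. *)
Definition mixing_gap (Q : qso) (n : nat) : R :=
  sup [set `|qso_chain Q p.1.1 0 n p.1.2 - qso_chain Q p.1.1 0 n p.2|
      | p in densities `*` densities `*` densities].

Lemma mixing_gap_ub (Q : qso) (n : nat) (f g h : L1) :
  densities f -> densities g -> densities h ->
  `|qso_chain Q f 0 n g - qso_chain Q f 0 n h| <= mixing_gap Q n.
Proof.
move=> Df Dg Dh; apply: ub_le_sup; last by exists (f, g, h).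
exists 2 => _ [[[f' g'] h'] [[/= Df' Dg'] Dh'] <-].
apply: (le_trans (ler_normB _ _)).
by rewrite (qso_chain_densities Q 0 n Df' Dg').2
  (qso_chain_densities Q 0 n Df' Dh').2.
Qed.

Definition norm_quasi_mixing : set qso :=
  [set Q | mixing_gap Q n @[n --> \oo] --> (0 : R)].

End L1_space.

Arguments densities {R d X} mu.
Arguments norm_quasi_mixing {R d X} mu.

(* Main.v *)
Require Import Defs.
From HB Require Import structures.
From mathcomp Require Import all_boot all_order all_algebra.
From mathcomp Require Import sesquilinear.
From mathcomp Require Import all_classical all_reals all_analysis.
From mathcomp Require Import lra measurable_realfun.

Set Implicit Arguments.
Unset Strict Implicit.
Unset Printing Implicit Defensive.

(* If g - h has zero integral then it is |g - h|_1 / 2 times a difference of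
   two densities, so the gaps mixing_gap Q n are submultiplicative after
   division by 2. They are also nonincreasing, hence Q is norm quasi-mixing as
   soon as mixing_gap Q n < 2 for a single n. By polarization the n-step chain
   is Lipschitz in Q for d_u, so this is an open condition. For density, mix Q
   with a small multiple of the operator (f, g) |-> (int f) (int g) h0, where
   h0 is a fixed density: one step then contracts differences of densities by
   a factor 1 - e. *)

Import Order.TTheory GRing.Theory Num.Theory.
Import numFieldNormedType.Exports.

Local Open Scope classical_set_scope.
Local Open Scope ring_scope.

(** Linearity of [qso_mix_op] in one argument, stated abstractly: [u], [v] are values of [Q] and
    [x], [y] products of two integrals. *)
Lemma combination_linear (K : comNzRingType) (V : lmodType K) (a b c x y : K)
    (u v w : V) :
  b *: (a *: u + v) + (c * (a * x + y)) *: w =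
  a *: (b *: u + (c * x) *: w) + (b *: v + (c * y) *: w).
Proof.
rewrite !scalerDr [RHS]addrACA !scalerA -scalerDl (mulrC a b).
by congr (_ + _ *: _); rewrite mulrDr mulrCA.
Qed.

Lemma subr_telescope3 (V : zmodType) (a b c e : V) :
  a - e = (a - b) + (b - c) + (c - e).
Proof. by rewrite !subrKA. Qed.

Lemma subr_telescope_swap (V : zmodType) (a b a' b' : V) :
  a' - b' = (a - b) + (b - b') - (a - a').
Proof. by rewrite subrKA opprB [RHS]addrC subrKA. Qed.

(** * The integral functional and Jordan decomposition *)

Section L1_integral.
Context (R : realType) (d : measure_display) (X : measurableType d).
Variable mu : {measure set X -> \bar R}.
Local Notation L1 := (L1 mu).
Local Notation Lfun1 := (LfunType mu (@lexx _ _ 1%E)).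

Definition L1_integral (F : L1) : R := (\int[mu]_x L1_fun F x)%R.

Lemma L1_integral_class (f : Lfun1) :
  L1_integral (L1_class f) = (\int[mu]_x f x)%R.
Proof.
rewrite /L1_integral /Rintegral; congr fine; apply: ae_eq_integral => //.
- apply/measurable_EFinP.
  exact: (@measurable_funPT _ _ _ _ (L1_repr (L1_class f))).
- by apply/measurable_EFinP; exact: (@measurable_funPT _ _ _ _ f).
- by apply: filterS (L1_classE f) => x /= /[apply] ->.
Qed.

Lemma L1_integral_is_linear : scalar L1_integral.
Proof.
move=> a F G; rewrite -[F]L1_reprK -[G]L1_reprK -linearP !L1_integral_class.
have iF (f : Lfun1) : mu.-integrable setT (EFin \o f).
  by apply/Lfun1_integrable; exact: LfunP.
rewrite -RintegralZl// -RintegralD//.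
exact: (iF (a *: L1_repr F)).
Qed.

HB.instance Definition _ :=
  GRing.isLinear.Build R L1 R *%R L1_integral L1_integral_is_linear.

Lemma L1_normE (F : L1) : `|F| = L1_norm F. Proof. by []. Qed.

Lemma L1_integral_nonneg (F : L1) : L1_nonneg F -> L1_integral F = `|F|.
Proof.
move=> F0; rewrite L1_normE /L1_norm /L1_integral /Rintegral; congr fine.
have mF : measurable_fun setT (L1_fun F).
  exact: (@measurable_funPT _ _ _ _ (L1_repr F)).
apply: ae_eq_integral => //.
- exact/measurable_EFinP.
- by apply/measurable_EFinP; exact: measurableT_comp.
- by apply: filterS F0 => x /= Fx _; rewrite ger0_norm.
Qed.

Lemma L1_norm_nonnegD (F G : L1) : L1_nonneg F -> L1_nonneg G ->
  `|F + G| = `|F| + `|G|.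
Proof.
move=> F0 G0; rewrite -[`|F|]L1_integral_nonneg// -[`|G|]L1_integral_nonneg//.
by rewrite -linearD /= L1_integral_nonneg//; exact: L1_nonnegD.
Qed.

(** The parts are the classes of (|f| + f)/2 and (|f| - f)/2. Their sum is |f|, and the norm is
    additive on nonnegative elements, where it equals the integral. *)
Lemma L1_jordan (F : L1) : exists G H : L1,
  [/\ L1_nonneg G, L1_nonneg H, F = G - H & `|F| = `|G| + `|H|].
Proof.
rewrite -[F]L1_reprK; move: (L1_repr F) => f.
pose g : Lfun1 := Lfun_Sub (@lexx _ _ 1%E) (Lfun_norm (LfunP f)).
have G0 : L1_nonneg (L1_class (2^-1 *: (g + f))).
  apply/L1_nonneg_class; apply: aeW => x.
  change (0 <= 2^-1 * (`|f x| + f x)).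
  by have := ler_norm (- f x); rewrite normrN; lra.
have H0 : L1_nonneg (L1_class (2^-1 *: (g - f))).
  apply/L1_nonneg_class; apply: aeW => x.
  change (0 <= 2^-1 * (`|f x| - f x)).
  by have := ler_norm (f x); lra.
exists (L1_class (2^-1 *: (g + f))), (L1_class (2^-1 *: (g - f))).
split => //.
  rewrite -raddfB /=; apply: (congr1 (@L1_class _ _ _ _)); apply/LfuneqP => x.
  change (f x = 2^-1 * (`|f x| + f x) - 2^-1 * (`|f x| - f x)).
  by lra.
rewrite -L1_norm_nonnegD// -[RHS]L1_integral_nonneg; last exact: L1_nonnegD.
rewrite -raddfD L1_integral_class L1_normE L1_norm_class.
apply: eq_Rintegral => x _.
change (`|f x| = 2^-1 * (`|f x| + f x) + 2^-1 * (`|f x| - f x)).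
by lra.
Qed.

Lemma L1_integral_densities (F : L1) : densities mu F -> L1_integral F = 1.
Proof. by move=> [F0 F1]; rewrite L1_integral_nonneg. Qed.

Lemma densities_half (F G : L1) : densities mu F -> densities mu G ->
  densities mu (2^-1 *: (F + G)).
Proof.
move=> [F0 F1] [G0 G1]; split.
  by apply: L1_nonnegZ; [rewrite invr_ge0|exact: L1_nonnegD].
by rewrite normrZ L1_norm_nonnegD// F1 G1 ger0_norm ?invr_ge0//; lra.
Qed.

(** Zero integral forces both Jordan parts to have norm |F|/2; normalizing them gives the two
    densities. *)
Lemma L1_zero_integral (F : L1) : L1_integral F = 0 -> F != 0 ->
  exists G H : L1,
    [/\ densities mu G, densities mu H & F = (`|F| / 2) *: (G - H)].
Proof.
move=> IF Fn0; have [G [H [G0 H0 FGH nF]]] := L1_jordan F.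
have GH : `|G| = `|H|.
  rewrite -(L1_integral_nonneg G0) -(L1_integral_nonneg H0); apply/eqP.
  rewrite -subr_eq0 -IF FGH.
  by rewrite -raddfB.
have F0 : `|F| != 0 by rewrite normr_eq0.
have nG : `|F| / 2 = `|G| by rewrite nF -GH; lra.
have Gn0 : `|G| != 0 by rewrite -nG mulf_neq0// invr_eq0.
exists (`|G|^-1 *: G), (`|H|^-1 *: H); split.
- by apply: densities_normalize => //; rewrite -normr_eq0.
- by apply: densities_normalize => //; rewrite -normr_eq0 -GH.
- by rewrite nG -GH -scalerBr scalerA divff// scale1r.
Qed.

End L1_integral.

(** * Norm bounds and composition of chains *)

Section qso_theory.
Context (R : realType) (d : measure_display) (X : measurableType d).
Variable mu : {measure set X -> \bar R}.
Local Notation L1 := (L1 mu).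
Local Notation D := (densities mu).
Implicit Types (Q : qso mu) (f g h : L1).

Lemma qso_densities Q f g : D f -> D g -> D (Q f g).
Proof.
by move=> [f0 f1] [g0 g1]; split; [exact: qso_nonneg|rewrite qso_norm// f1 g1 mulr1].
Qed.

(** After Jordan decomposition of both arguments, the four cross terms have norms summing exactly to
    the product of the norms. *)
Lemma qso_norm_le Q f g : `|Q f g| <= `|f| * `|g|.
Proof.
have [f1 [f2 [f10 f20 -> ->]]] := L1_jordan f.
have [g1 [g2 [g10 g20 -> ->]]] := L1_jordan g.
rewrite linearBl !linearBr /= mulrDl !mulrDr -!(qso_norm Q)//.
apply: (le_trans (ler_normB _ _)).
by apply: lerD; exact: ler_normB.
Qed.

Lemma iter_diag_densities Q f n : D f -> D (iter n (qso_diag Q) f).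
Proof. by move=> Df; elim: n => //= n; exact: qso_diag_densities. Qed.

Lemma qso_chain0 Q f g : qso_chain Q f 0 0 g = g.
Proof. by []. Qed.

Lemma qso_chainS Q f n g :
  qso_chain Q f 0 n.+1 g = Q (iter n (qso_diag Q) f) (qso_chain Q f 0 n g).
Proof. by rewrite /qso_chain /index_iota !subn0 -addn1 iotaD foldl_cat. Qed.

(** The chain is nonhomogeneous: its last [n] steps form a chain driven by the [m]-th iterate of [f]
    instead of [f]. *)
Lemma qso_chainD Q f m n g : qso_chain Q f 0 (m + n) g =
  qso_chain Q (iter m (qso_diag Q) f) 0 n (qso_chain Q f 0 m g).
Proof.
elim: n => [|n IHn]; first by rewrite addn0.
by rewrite addnS !qso_chainS IHn -iterD addnC.
Qed.

(** Makes orbits a special case of chains, so that a bound on chains also controls the driving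
    densities. *)
Lemma qso_chain_self Q f n : qso_chain Q f 0 n f = iter n (qso_diag Q) f.
Proof. by elim: n => // n IHn; rewrite qso_chainS IHn. Qed.

Lemma qso_chain_is_linear Q f n : linear (qso_chain Q f 0 n).
Proof. by move=> a g h; elim: n => // n IHn; rewrite !qso_chainS IHn linearPr. Qed.

HB.instance Definition _ Q f n := GRing.isLinear.Build R L1 L1 *:%R
  (qso_chain Q f 0 n) (qso_chain_is_linear Q f n).

(** * Mixing gaps and the criterion for quasi-mixing *)

Lemma mixing_gap_le Q n e : 0 <= e ->
  (forall f g h, D f -> D g -> D h ->
    `|qso_chain Q f 0 n g - qso_chain Q f 0 n h| <= e) ->
  mixing_gap Q n <= e.
Proof.
move=> e0 He; rewrite /mixing_gap; set S := [set _ | _ in _].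
have [->|/set0P S0] := eqVneq S set0; first by rewrite sup0.
by apply: ge_sup => // _ [[[f g] h] [[Df Dg] Dh] <-]; exact: He.
Qed.

Lemma mixing_gap_ge0 Q n : 0 <= mixing_gap Q n.
Proof.
rewrite /mixing_gap; set S := [set _ | _ in _].
have [->|/set0P [_ [[[f g] h] [[Df Dg] Dh] _]]] := eqVneq S set0.
  by rewrite sup0.
by apply: le_trans (mixing_gap_ub Q n Df Dg Dh).
Qed.

Lemma mixing_gap_nonincreasing Q : nonincreasing_seq (mixing_gap Q).
Proof.
apply/nonincreasing_seqP => n; apply: mixing_gap_le => [|f g h Df Dg Dh].
  exact: mixing_gap_ge0.
rewrite !qso_chainS -linearBr; apply: (le_trans (qso_norm_le _ _ _)).
by rewrite (iter_diag_densities Q n Df).2 mul1r mixing_gap_ub.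
Qed.

(** The difference [F] after [m] steps has zero integral, hence is |F|/2 times a difference of
    densities. The remaining steps are driven by [u]; the supremum over all driving densities in
    [mixing_gap] covers this. *)
Lemma mixing_gapD Q m n :
  mixing_gap Q (m + n) <= mixing_gap Q m / 2 * mixing_gap Q n.
Proof.
have gap0 := mixing_gap_ge0 Q.
apply: mixing_gap_le => [|f g h Df Dg Dh].
  by rewrite !mulr_ge0// invr_ge0.
rewrite !qso_chainD -linearB /=.
set F := _ - _; set u := iter _ _ _.
have Du : D u by exact: iter_diag_densities.
have [->|Fn0] := eqVneq F 0.
  by rewrite linear0 normr0 !mulr_ge0// invr_ge0.
have IF : L1_integral F = 0.
  by rewrite linearB /= !L1_integral_densities ?subrr//; exact: qso_chain_densities.
have [G [H [DG DH ->]]] := L1_zero_integral IF Fn0.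
rewrite linearZ /= normrZ linearB /= ger0_norm ?divr_ge0//.
apply: ler_pM; rewrite ?divr_ge0 ?mixing_gap_ub//.
by rewrite ler_pM2r ?invr_gt0 ?mixing_gap_ub.
Qed.

Lemma norm_quasi_mixingP Q :
  norm_quasi_mixing mu Q <-> exists n, mixing_gap Q n < 2.
Proof.
split=> [Qmix|[n gapn]].
  near \oo => n; exists n; rewrite -[ltLHS]ger0_norm ?mixing_gap_ge0//.
  by near: n; apply: (cvgr0_norm_lt _ Qmix).
have cv : cvgn (mixing_gap Q).
  apply: nonincreasing_is_cvgn; first exact: mixing_gap_nonincreasing.
  by exists 0 => _ [k _ <-]; exact: mixing_gap_ge0.
have l0 : 0 <= limn (mixing_gap Q).
  by apply: limr_ge => //; apply: nearW => k; exact: mixing_gap_ge0.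
(* Passing to the limit in [mixing_gapD] with [n] fixed; as [mixing_gap Q n / 2 < 1], the limit must
   vanish. *)
have lim_le : limn (mixing_gap Q) <= limn (mixing_gap Q) / 2 * mixing_gap Q n.
  apply: (@ler_cvg_to _ \oo _ _ (fun k => mixing_gap Q (k + n))
    (fun k => mixing_gap Q k / 2 * mixing_gap Q n)).
  - by rewrite cvg_shiftn.
  - by apply: cvgMr_tmp; apply: cvgMr_tmp.
  - by apply: nearW => k; exact: mixing_gapD.
have : limn (mixing_gap Q) = 0.
  by apply/eqP; rewrite eq_le l0 andbT; nra.
by move=> l; rewrite /norm_quasi_mixing /= -l.
Unshelve. all: by end_near. Qed.

(** * Lipschitz dependence on the operator, and openness *)

Lemma qso_polarization Q1 Q2 f g : D f -> D g ->
  `|Q1 f g - Q2 f g| <= 3 * qso_dist Q1 Q2.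
Proof.
move=> Df Dg; set e := qso_dist Q1 Q2.
have Dh := densities_half Df Dg.
have H1 := qso_dist_ub Q1 Q2 Df; have H2 := qso_dist_ub Q1 Q2 Dg.
have H3 := qso_dist_ub Q1 Q2 Dh.
pose q h : L1 := qso_diag Q1 h - qso_diag Q2 h.
(* The metric sees only the diagonal, so the midpoint, again a density, is used to recover the cross
   term. The coefficients 2, 1/2, 1/2 add up to the constant 3. *)
have -> : Q1 f g - Q2 f g =
    2 *: q (2^-1 *: (f + g)) - 2^-1 *: q f - 2^-1 *: q g.
  have -> : 2 *: q (2^-1 *: (f + g)) =
      2^-1 *: (q f + q g + (Q1 f g - Q2 f g) *+ 2).
    rewrite /q /qso_diag !linearZl_LR !linearZr_LR /= -!scalerBr !scalerA.
    rewrite mulrA divff ?pnatr_eq0// mul1r; congr (_ *: _).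
    rewrite !linearDl !linearDr /=.
    rewrite (qso_sym Q1 Dg.1 Df.1) (qso_sym Q2 Dg.1 Df.1).
    (* The pairs 1, 5 and 4, 8 are the diagonal differences; 2, 6 and 3, 7 are the two copies of the
       cross difference. *)
    by rewrite mulr2n !opprD !addrA [LHS](ACl (1*5*4*8*2*6*3*7)).
  rewrite -!scalerBr -addrA -opprD addrC addKr.
  rewrite -(scaler_nat 2 (Q1 f g - Q2 f g)) scalerA.
  by rewrite mulVf ?scale1r// pnatr_eq0.
rewrite -/(q _) -/e in H1 H2 H3.
apply: (le_trans (ler_normB _ _)).
have := ler_normB (2 *: q (2^-1 *: (f + g))) (2^-1 *: q f).
rewrite !normrZ ger0_norm// ger0_norm ?invr_ge0//.
lra.
Qed.

(** The constant c(n) = 3(2^n - 1) solves c(0) = 0, c(n+1) = 2 c(n) + 3: one c(n) from the driving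
    densities, one from the transported ones, and 3 from polarization. *)
Lemma qso_chain_lipschitz Q1 Q2 f g n : D f -> D g ->
  `|qso_chain Q1 f 0 n g - qso_chain Q2 f 0 n g|
    <= 3 * (2 ^+ n - 1) * qso_dist Q1 Q2.
Proof.
move=> Df; elim: n g => [|n IHn] g Dg.
  by rewrite !qso_chain0 subrr normr0 expr0 subrr mulr0 mul0r.
rewrite !qso_chainS; set u1 := iter _ _ _; set u2 := iter _ _ _.
set v1 := qso_chain Q1 _ _ _ _; set v2 := qso_chain Q2 _ _ _ _.
have Du2 : D u2 by exact: iter_diag_densities.
have Dv1 : D v1 by exact: qso_chain_densities.
have Dv2 : D v2 by exact: qso_chain_densities.
have -> : Q1 u1 v1 - Q2 u2 v2 =
    Q1 (u1 - u2) v1 + Q1 u2 (v1 - v2) + (Q1 u2 v2 - Q2 u2 v2).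
  by rewrite linearBl linearBr; exact: subr_telescope3.
have Hu : `|u1 - u2| <= 3 * (2 ^+ n - 1) * qso_dist Q1 Q2.
  by rewrite /u1 /u2 -!qso_chain_self; exact: IHn.
have Hv := IHn g Dg; rewrite -/v1 -/v2 in Hv.
have := ler_normD (Q1 (u1 - u2) v1 + Q1 u2 (v1 - v2)) (Q1 u2 v2 - Q2 u2 v2).
have := ler_normD (Q1 (u1 - u2) v1) (Q1 u2 (v1 - v2)).
have := qso_norm_le Q1 (u1 - u2) v1; rewrite Dv1.2 mulr1.
have := qso_norm_le Q1 u2 (v1 - v2); rewrite Du2.2 mul1r.
have := qso_polarization Q1 Q2 Du2 Dv2.
rewrite exprS; lra.
Qed.

Lemma mixing_gap_lipschitz Q1 Q2 n : mixing_gap Q2 n <=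
  mixing_gap Q1 n + 6 * (2 ^+ n - 1) * qso_dist Q1 Q2.
Proof.
have p2 : 0 <= 2 ^+ n - 1 :> R by rewrite subr_ge0 exprn_ege1// ler1n.
apply: mixing_gap_le => [|f g h Df Dg Dh].
  by rewrite addr_ge0 ?mixing_gap_ge0// !mulr_ge0// qso_dist_ge0.
have -> : qso_chain Q2 f 0 n g - qso_chain Q2 f 0 n h =
    (qso_chain Q1 f 0 n g - qso_chain Q1 f 0 n h)
    + (qso_chain Q1 f 0 n h - qso_chain Q2 f 0 n h)
    - (qso_chain Q1 f 0 n g - qso_chain Q2 f 0 n g).
  exact: subr_telescope_swap.
apply: (le_trans (ler_normB _ _)).
have := ler_normD (qso_chain Q1 f 0 n g - qso_chain Q1 f 0 n h)
  (qso_chain Q1 f 0 n h - qso_chain Q2 f 0 n h).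
have := qso_chain_lipschitz Q1 Q2 n Df Dg.
have := qso_chain_lipschitz Q1 Q2 n Df Dh.
have := mixing_gap_ub Q1 n Df Dg Dh.
lra.
Qed.

Lemma open_norm_quasi_mixing : open (norm_quasi_mixing mu).
Proof.
rewrite openE => Q /norm_quasi_mixingP [n gapn]; apply/nbhs_ballP.
set c : R := 6 * (2 ^+ n - 1).
have c0 : 0 <= c by rewrite mulr_ge0// subr_ge0 exprn_ege1// ler1n.
(* [c] is 0 when [n] is 0; adding 1 keeps the radius well defined. *)
have c1 : 0 < c + 1 by lra.
exists ((2 - mixing_gap Q n) / (c + 1)) => /=.
  by rewrite divr_gt0// subr_gt0.
move=> Q'; rewrite ballEmdist /= => dQ; apply/norm_quasi_mixingP; exists n.
have := mixing_gap_lipschitz Q Q' n; rewrite -/c.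
have {}dQ : qso_dist Q Q' < (2 - mixing_gap Q n) / (c + 1) by exact: dQ.
move: dQ; rewrite ltr_pdivlMr// => dQ.
have := qso_dist_ge0 Q Q'; lra.
Qed.

(** * Density by perturbation *)

Section perturbation.
Variables (Q : qso mu) (h0 : L1) (Dh0 : D h0) (e : R).
Hypothesis e01 : 0 <= e <= 1.

(** Integrals rather than norms make this bilinear on all of [L1]; the two agree on nonnegative
    elements. *)
Definition qso_mix_op f g : L1 :=
  (1 - e) *: Q f g + (e * (L1_integral f * L1_integral g)) *: h0.

Lemma qso_mix_op_bilinear :
  bilinear_for ( *:%R : R -> L1 -> L1) ( *:%R : R -> L1 -> L1) qso_mix_op.
Proof.
split=> [g a f1 f2|f a g1 g2]; rewrite /qso_mix_op L1_integral_is_linear.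
  by rewrite linearPl mulrDl -mulrA; exact: combination_linear.
by rewrite linearPr mulrDr mulrCA; exact: combination_linear.
Qed.

HB.instance Definition _ := bilinear_isBilinear.Build R L1 L1 L1 *:%R *:%R
  qso_mix_op qso_mix_op_bilinear.

Let qso_mix_nonneg f g : L1_nonneg f -> L1_nonneg g -> L1_nonneg (qso_mix_op f g).
Proof.
move=> f0 g0; have /andP[e0 e1] := e01; apply: L1_nonnegD.
  by apply: L1_nonnegZ; [rewrite subr_ge0|exact: qso_nonneg].
apply: L1_nonnegZ Dh0.1.
by rewrite !L1_integral_nonneg// !mulr_ge0.
Qed.

Let qso_mix_sym f g : L1_nonneg f -> L1_nonneg g ->
  qso_mix_op f g = qso_mix_op g f.
Proof.
by move=> f0 g0; rewrite /qso_mix_op (qso_sym Q f0 g0) (mulrC (L1_integral f)).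
Qed.

Let qso_mix_norm f g : L1_nonneg f -> L1_nonneg g ->
  `|qso_mix_op f g| = `|f| * `|g|.
Proof.
move=> f0 g0; have /andP[e0 e1] := e01.
have c0 : 0 <= e * (`|f| * `|g|) by rewrite !mulr_ge0.
rewrite /qso_mix_op !L1_integral_nonneg// L1_norm_nonnegD.
- rewrite !normrZ Dh0.2 qso_norm// !ger0_norm ?subr_ge0//; lra.
- by apply: L1_nonnegZ; [rewrite subr_ge0|exact: qso_nonneg].
- exact: L1_nonnegZ Dh0.1.
Qed.

Definition qso_mix : qso mu := QSO qso_mix_nonneg qso_mix_sym qso_mix_norm.

Lemma qso_dist_mix : qso_dist Q qso_mix <= 2 * e.
Proof.
have /andP[e0 e1] := e01.
apply: qso_dist_le => [|f Df]; first by rewrite mulr_ge0.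
have -> : qso_diag Q f - qso_diag qso_mix f = e *: (Q f f - h0).
  rewrite /qso_diag /= /qso_mix_op L1_integral_densities// !mulr1.
  by rewrite scalerBl scale1r scalerBr opprD opprB addrA subrKC.
rewrite normrZ ger0_norm// mulrC ler_wpM2r//.
apply: (le_trans (ler_normB _ _)).
by rewrite (qso_densities Q Df Df).2 Dh0.2.
Qed.

(** The [h0] terms cancel because [g] and [h] have the same integral, leaving [1 - e] times a
    difference of densities under [Q]. *)
Lemma mixing_gap_mix : mixing_gap qso_mix 1 <= 2 * (1 - e).
Proof.
have /andP[e0 e1] := e01.
apply: mixing_gap_le => [|f g h Df Dg Dh]; first by rewrite mulr_ge0// subr_ge0.
rewrite !qso_chainS /= /qso_mix_op !L1_integral_densities//.
rewrite opprD addrACA subrr addr0 -scalerBr -linearBr normrZ ger0_norm ?subr_ge0//.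
rewrite mulrC ler_wpM2r ?subr_ge0//.
apply: (le_trans (qso_norm_le _ _ _)); rewrite Df.2 mul1r.
by apply: (le_trans (ler_normB _ _)); rewrite Dg.2 Dh.2.
Qed.

End perturbation.

Lemma dense_norm_quasi_mixing : dense (norm_quasi_mixing mu).
Proof.
move=> O [Q OQ] oO.
have [D0|/set0P [h0 Dh0]] := eqVneq D set0.
  (* Without densities the gap is the supremum of the empty set, which is 0, so [Q] itself
     qualifies. *)
  exists Q; split => //; apply/norm_quasi_mixingP; exists 0.
  apply: (@le_lt_trans _ _ 0) => //.
  by apply: mixing_gap_le => // f g h; rewrite D0.
move: oO; rewrite openE => /(_ _ OQ) /nbhs_ballP[r /= r0 rO].
(* The bound 1 keeps the combination convex, and r/3 makes the distance bound 2e strictly less than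
   r. *)
pose e := Num.min 1 (r / 3).
have e0 : 0 < e by rewrite lt_min ltr01 divr_gt0.
have e01 : 0 <= e <= 1 by rewrite ltW// ge_min lexx.
have er : e <= r / 3 by rewrite ge_min lexx orbT.
exists (qso_mix Q Dh0 e01); split.
  apply: rO; rewrite ballEmdist /=.
  have := qso_dist_mix Q Dh0 e01 => H.
  by apply: (le_lt_trans H); lra.
apply/norm_quasi_mixingP; exists 1%N.
by apply: (le_lt_trans (mixing_gap_mix Q Dh0 e01)); lra.
Qed.

End qso_theory.

Unset Implicit Arguments.

Theorem theorem4p1 (R : realType) (d : measure_display) (X : measurableType d)
    (mu : {sigma_finite_measure set X -> \bar R})
    (mu_separable : separable_measure mu)
    (dim_neq1 : ~ has_dim (L1 mu) 1) :
  dense (norm_quasi_mixing mu) /\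
  open (norm_quasi_mixing mu).
Proof.
by split; [exact: dense_norm_quasi_mixing|exact: open_norm_quasi_mixing].
Qed.
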